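(* Let $d \ge 2$, let $B \in \mathbb{R}^d \setminus \{\mathbf{0}\}$, and let $A_L, A_R$ be real $d \times d$ matrices, neither of which has $0$ as an eigenvalue, with $A_L - A_R = C B^{\mathsf{T}}$ for some $C \in \mathbb{R}^d$. Let $D : \mathbb{S}^{d-1} \to (0,\infty)$ and $G : \mathbb{S}^{d-1} \to \mathbb{S}^{d-1}$ be given by $$D(\mathbf{z}) = \begin{cases} \|A_L \mathbf{z}\|, & B^{\mathsf{T}}\mathbf{z} \le 0, \\ \|A_R \mathbf{z}\|, & B^{\mathsf{T}}\mathbf{z} \ge 0, \end{cases} \qquad G(\mathbf{z}) = \begin{cases} \frac{A_L \mathbf{z}}{\|A_L \mathbf{z}\|}, & B^{\mathsf{T}}\mathbf{z} \le 0, \\ \frac{A_R \mathbf{z}}{\|A_R \mathbf{z}\|}, & B^{\mathsf{T}}\mathbf{z} \ge 0. \end{cases}$$ A point $\mathbf{z}^* \in \mathbb{S}^{d-1}$ is a fixed point of $G$ if and only if it is an eigenvector of $A_L$ or $A_R$ corresponding to an eigenvalue $\lambda > 0$. Moreover, $\lambda = D(\mathbf{z}^* )$.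
   Context: $\|\cdot\|$ is the Euclidean norm and $\mathbb{S}^{d-1} = \{\mathbf{x} \in \mathbb{R}^d : \|\mathbf{x}\| = 1\}$. The condition $A_L - A_R = C B^{\mathsf{T}}$ ensures that the two formulas agree on $B^{\mathsf{T}}\mathbf{z} = 0$, so $D$ and $G$ are well-defined and continuous.
   Formalization: The eigenvector condition is required of the matrix acting at z*: A_L with B^T z* ≤ 0, or A_R with B^T z* ≥ 0; without this the claim is false (B = e_1, A_L = I, A_R = diag(-1,1), z* = e_1), and λ = D(z* ) is stated for such λ. *)

(* Defs.v *)
From mathcomp Require Import all_boot all_order all_algebra.
From mathcomp Require Import reals.

Set Implicit Arguments.
Unset Strict Implicit.
Unset Printing Implicit Defensive.

Import Order.TTheory GRing.Theory Num.Theory.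
Local Open Scope ring_scope.

(* The library norm on matrices is the sup norm, hence this definition. *)
Definition enorm (R : realType) (d : nat) (v : 'cV[R]_d) : R :=
  Num.sqrt (\sum_(i < d) v i 0 ^+ 2).

Definition dotv (R : realType) (d : nat) (u v : 'cV[R]_d) : R :=
  (u^T *m v) 0 0.

Definition sphere (R : realType) (d : nat) : Type :=
  {z : 'cV[R]_d | enorm z == 1}.

(* Matrices act on columns here, whereas the library's [eigenvalue] and
   [eigenspace] are about row vectors acted upon from the right.
   [col_eigenvalueP] below shows that the eigenvalues are the same. *)
Definition eigenvector (R : realType) (d : nat) (A : 'M[R]_d) (a : R)
    (v : 'cV[R]_d) : Prop :=
  v != 0 /\ A *m v = a *: v.

Lemma col_eigenvalueP (R : realType) (d : nat) (A : 'M[R]_d) (a : R) :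
  reflect (exists v, eigenvector A a v) (eigenvalue A a).
Proof.
have -> : eigenvalue A a = eigenvalue A^T a.
  rewrite /eigenvalue /eigenspace -!mxrank_eq0 !mxrank_ker.
  by rewrite -{2}[a%:M]tr_scalar_mx -linearB /= mxrank_tr.
apply: (iffP eigenvalueP) => [[v vA v0] | [v [v0 Av]]].
  exists v^T; split; first by rewrite trmx_eq0.
  by rewrite -[A]trmxK -trmx_mul vA linearZ.
by exists v^T; rewrite ?trmx_eq0 // -trmx_mul Av linearZ.
Qed.

Section Norm.
Variables (R : realType) (d : nat).
Implicit Types v : 'cV[R]_d.

Lemma enorm_eq0 v : (enorm v == 0) = (v == 0).
Proof.
have sq_ge0 (i : 'I_d) : true -> 0 <= v i 0 ^+ 2 by rewrite sqr_ge0.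
rewrite sqrtr_eq0; apply/idP/eqP => [s_le0 | ->]; last first.
  by rewrite big1 // => i _; rewrite mxE expr0n.
have s0 : \sum_(i < d) v i 0 ^+ 2 = 0.
  by apply/eqP; rewrite eq_le s_le0 sumr_ge0.
apply/matrixP => i j; rewrite mxE (ord1 j).
by apply/eqP; rewrite -sqrf_eq0 (psumr_eq0P sq_ge0 s0).
Qed.

Lemma enorm_gt0 v : (0 < enorm v) = (v != 0).
Proof. by rewrite lt_def enorm_eq0 sqrtr_ge0 andbT. Qed.

Lemma enormZ (a : R) v : enorm (a *: v) = `|a| * enorm v.
Proof.
rewrite /enorm -sqrtr_sqr -sqrtrM ?sqr_ge0 // mulr_sumr.
by congr Num.sqrt; apply: eq_bigr => i _; rewrite mxE exprMn.
Qed.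

Lemma enorm_normalize v : v != 0 -> enorm ((enorm v)^-1 *: v) == 1.
Proof.
rewrite -enorm_gt0 => v_gt0.
by rewrite enormZ ger0_norm ?invr_ge0 ?ltW // mulVf // gt_eqF.
Qed.

Lemma sphere_neq0 (z : sphere R d) : val z != 0.
Proof. by rewrite -enorm_eq0 (eqP (valP z)) oner_eq0. Qed.

Lemma mulmx_sphere_neq0 (A : 'M[R]_d) (z : sphere R d) :
  ~~ eigenvalue A 0 -> A *m val z != 0.
Proof.
move=> hA; apply: contraNneq hA => Az0; apply/col_eigenvalueP.
by exists (val z); split; [exact: sphere_neq0 | rewrite Az0 scale0r].
Qed.

End Norm.

Definition push (R : realType) (d : nat) (A : 'M[R]_d)
    (hA : ~~ eigenvalue A 0) (z : sphere R d) : sphere R d :=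
  exist _ ((enorm (A *m val z))^-1 *: (A *m val z))
    (enorm_normalize (mulmx_sphere_neq0 z hA)).

(* In [Dmap] and [Gmap] the overlap [dotv B z = 0] is assigned to the left
   piece; [Dmap_right] and [Gmap_right] show that the formula of the right
   piece holds there too when [AL - AR = C *m B^T]. *)
Definition Dmap (R : realType) (d : nat) (B : 'cV[R]_d) (AL AR : 'M[R]_d)
    (z : sphere R d) : R :=
  if dotv B (val z) <= 0 then enorm (AL *m val z) else enorm (AR *m val z).

Definition Gmap (R : realType) (d : nat) (B : 'cV[R]_d) (AL AR : 'M[R]_d)
    (hL : ~~ eigenvalue AL 0) (hR : ~~ eigenvalue AR 0)
    (z : sphere R d) : sphere R d :=
  if dotv B (val z) <= 0 then push hL z else push hR z.

Section Pieces.
Variables (R : realType) (d : nat) (B C : 'cV[R]_d) (AL AR : 'M[R]_d).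
Hypotheses (hL : ~~ eigenvalue AL 0) (hR : ~~ eigenvalue AR 0).
Hypothesis hC : AL - AR = C *m B^T.
Variable z : sphere R d.

Lemma Dmap_gt0 : 0 < Dmap B AL AR z.
Proof. by rewrite /Dmap; case: ifP; rewrite enorm_gt0 mulmx_sphere_neq0. Qed.

Lemma overlap : dotv B (val z) = 0 -> AL *m val z = AR *m val z.
Proof.
move=> Bz0; apply/eqP; rewrite -subr_eq0 -mulmxBl hC -mulmxA.
by rewrite [B^T *m _]mx11_scalar -/(dotv B (val z)) Bz0 raddf0 mulmx0.
Qed.

Lemma Dmap_left :
  dotv B (val z) <= 0 -> Dmap B AL AR z = enorm (AL *m val z).
Proof. by rewrite /Dmap => ->. Qed.

Lemma Dmap_right :
  0 <= dotv B (val z) -> Dmap B AL AR z = enorm (AR *m val z).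
Proof.
rewrite /Dmap => Bz_ge0; case: ifP => // Bz_le0.
by rewrite overlap //; apply/eqP; rewrite eq_le Bz_le0.
Qed.

Lemma Gmap_left : dotv B (val z) <= 0 ->
  val (Gmap B hL hR z) = (enorm (AL *m val z))^-1 *: (AL *m val z).
Proof. by rewrite /Gmap => ->. Qed.

Lemma Gmap_right : 0 <= dotv B (val z) ->
  val (Gmap B hL hR z) = (enorm (AR *m val z))^-1 *: (AR *m val z).
Proof.
rewrite /Gmap => Bz_ge0; case: ifP => // Bz_le0 /=.
by rewrite overlap //; apply/eqP; rewrite eq_le Bz_le0.
Qed.

End Pieces.

(* Main.v *)
Require Import Defs.
From mathcomp Require Import all_boot all_order all_algebra.
From mathcomp Require Import reals.

(** On either piece, [G] is a linear map followed by rescaling to norm one.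
    Such a rescaling divides by a positive number, so it returns [z] exactly
    when [A z] is a positive multiple of [z]; since [z] has norm one, that
    multiple can only be the norm of [A z].  Hence a fixed point of the
    normalized linear map is the same as an eigenvector with positive
    eigenvalue ([push_fixedP]), and the eigenvalue is the stretching factor
    ([enorm_pos_eigenvector]).

    What remains is to choose the piece by the sign of [dotv B z].  The one
    delicate case is an eigenvector of the right-hand matrix on the switching
    hyperplane [dotv B z = 0], where both formulas apply: there the rank-one
    hypothesis on [AL - AR] makes the two pieces agree ([Gmap_right] and
    [Dmap_right]). *)

Import Order.TTheory GRing.Theory Num.Theory.
Local Open Scope ring_scope.

Lemma enorm_pos_eigenvector {R : realType} {d : nat} {A : 'M[R]_d}
    {z : sphere R d} {lam : R} :
  0 < lam -> eigenvector A lam (val z) -> enorm (A *m val z) = lam.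
Proof.
by move=> lam_gt0 [_ ->]; rewrite enormZ (eqP (valP z)) mulr1 gtr0_norm.
Qed.

(** The eigenvalue of a fixed point is the factor removed by the rescaling,
    which is positive because [A] is injective. *)
Lemma push_fixedP {R : realType} {d : nat} {A : 'M[R]_d}
    (hA : ~~ eigenvalue A 0) (z : sphere R d) :
  push hA z = z <-> exists2 lam : R, 0 < lam & eigenvector A lam (val z).
Proof.
have Az_gt0 : 0 < enorm (A *m val z) by rewrite enorm_gt0 mulmx_sphere_neq0.
split=> [/(congr1 val) /= fix_z | [lam lam_gt0 eig]].
  exists (enorm (A *m val z)) => //; split; first exact: sphere_neq0.
  by rewrite -[in RHS]fix_z scalerA mulfV ?gt_eqF // scale1r.
apply: val_inj => /=; rewrite (enorm_pos_eigenvector lam_gt0 eig).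
by case: eig => _ ->; rewrite scalerA mulVf ?gt_eqF // scale1r.
Qed.

Theorem lemma5p1 (R : realType) (d : nat) (hd : (2 <= d)%N)
    (B : 'cV[R]_d) (hB : B != 0) (AL AR : 'M[R]_d)
    (hL : ~~ eigenvalue AL 0) (hR : ~~ eigenvalue AR 0)
    (hC : exists C : 'cV[R]_d, AL - AR = C *m B^T)
    (z : sphere R d) :
  (Gmap B hL hR z = z <->
   exists lam : R, 0 < lam /\
     ((dotv B (val z) <= 0 /\ eigenvector AL lam (val z)) \/
      (0 <= dotv B (val z) /\ eigenvector AR lam (val z)))) /\
  (forall lam : R, 0 < lam ->
     (dotv B (val z) <= 0 /\ eigenvector AL lam (val z)) \/
     (0 <= dotv B (val z) /\ eigenvector AR lam (val z)) ->
     lam = Dmap B AL AR z).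
Proof.
case: hC => C eqC; split; last first.
  move=> lam lam_gt0 [] [sgn /(enorm_pos_eigenvector lam_gt0) <-].
    by rewrite Dmap_left.
  by rewrite (Dmap_right eqC).
split=> [|[lam [lam_gt0 [] [sgn eig]]]].
- rewrite /Gmap; case: leP => [Bz_le0 | /ltW Bz_ge0] /push_fixedP[lam ? ?].
    by exists lam; split=> //; left.
  by exists lam; split=> //; right.
- by rewrite /Gmap sgn; apply/push_fixedP; exists lam.
- (* On the switching hyperplane [Gmap] unfolds to the left piece, so the
     comparison with the right piece is made on underlying vectors. *)
  apply: val_inj; rewrite (Gmap_right hL hR eqC sgn).
  have /(congr1 val) // : push hR z = z.
  by apply/push_fixedP; exists lam.
Qed.
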